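(* For any integer $p > 1$, the functions $\sin_p^{-1} x$ and $\sin_p x$ are analytic at $x = 0$.
   Context: For an integer $p>1$, near $0$ the function $\sin_p t = y(t)$ is the second component of the unique solution, defined on an open interval around $0$, of the initial value problem $x'(t) = -y(t)^{p-1}$, $y'(t) = x(t)^{p-1}$, $x(0)=1$, $y(0)=0$. Its inverse near $0$ is $\sin_p^{-1}x = \int_0^x \frac{dt}{(1-t^p)^{\frac{p-1}{p}}}$ for $|x|<1$. A function $f$ is analytic at $c$ if it is infinitely differentiable at $c$ and its Taylor series at $c$ converges to $f(w)$ for all $w$ in a neighborhood of $c$. *)

(* Defs.v *)
From Stdlib Require Import Reals Factorial ClassicalEpsilon.
From Coquelicot Require Import Coquelicot.
Open Scope R_scope.

(* [Derive_n] is total, so [ex_derive_n f n c] alone would not force the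
   lower-order derivatives to exist around [c]; hence the first [locally]. *)
Definition analytic_at (f : R -> R) (c : R) : Prop :=
  (forall n : nat, locally c (fun w => ex_derive_n f n w)) /\
  locally c (fun w =>
    is_pseries (fun n => Derive_n f n c / INR (fact n)) (w - c) (f w)).

Definition sin_p_ivp (p : nat) (a b : R) (x y : R -> R) : Prop :=
  x 0 = 1 /\ y 0 = 0 /\
  forall t : R, a < t < b ->
    is_derive x t (- (y t ^ (p - 1))) /\ is_derive y t (x t ^ (p - 1)).

Definition is_sin_p (p : nat) (y : R -> R) : Prop :=
  exists (a b : R) (x : R -> R), a < 0 < b /\ sin_p_ivp p a b x y.

(* Two solutions of the initial value problem agree around 0, so the germ of
   [sin_p p] at 0 does not depend on the choice; only that germ is meaningful. *)
Definition sin_p (p : nat) : R -> R :=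
  epsilon (inhabits (fun t : R => t)) (is_sin_p p).

(* Meaningful for |x| < 1, where 1 - t^p > 0 along the path of integration. *)
Definition arcsin_p (p : nat) (x : R) : R :=
  RInt (fun t => / Rpower (1 - t ^ p) (INR (p - 1) / INR p)) 0 x.

(* Main.v *)
Require Import Defs.
From Stdlib Require Import Reals.
From Coquelicot Require Import Coquelicot.
From Stdlib Require Import Lra Lia List ClassicalEpsilon.
From Stdlib Require FinFun.
Open Scope R_scope.

(** Both functions are components of solutions of autonomous ODE systems
    [u_i' = F_i(u)] with polynomial right-hand sides, and every solution of such
    a system is analytic ([solves_analytic]).  For [sin_p] the system is the
    defining one, in the unknowns [(x, y)].  For [arcsin_p] the non-polynomial
    integrand [h = (1 - t^p)^(-(p-1)/p)] becomes an unknown of its own, next to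
    [t] and [g = 1 / (1 - t^p)]: then [t' = 1], [g' = p t^(p-1) g^2],
    [h' = (p-1) t^(p-1) g h], and [arcsin_p' = h].

    To see that solutions are analytic, one constructs a power series solution
    and shows that any other solution has the same germ.

    Construction.  Comparing coefficients in [u_i' = F_i(u)] determines
    a formal power series [a_i] for each unknown.  Its convergence follows from
    a bound on the weighted partial sums [S_N(a) = sum_(k <= N) |a_k| r^k].
    These are submultiplicative for Cauchy products, so if [S_N(a_i) <= M] for
    all [i], then [S_N(F_i(a)) <= B], where [B] is the value at [M] of [F_i] with
    all coefficients replaced by their absolute values.  Integrating termwise
    gives [S_(N+1)(a_i) <= |a_i(0)| + r B], and choosing [M] first and then [r]
    small makes the bound [S_N(a_i) <= M] reproduce itself for all [N]
    ([partial_norm_formal_solution]).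

    Uniqueness.  Near 0 the [F_i] are Lipschitz along both solutions, with some
    constant [L].  On [|t| < e] with [L e <= 1/2], the mean value inequality
    turns a bound [K] on the difference of the two solutions into the bound
    [K / 2], so the difference vanishes ([solves_unique]).

    The power series solution also shows that [sin_p], defined by a choice
    among the solutions of its initial value problem, is a solution at all. *)

(** * Finite families of unknowns *)

Lemma locally_forall_finite (I : Type) (Q : I -> R -> Prop) (c : R) :
  FinFun.Finite I ->
  (forall i, locally c (Q i)) -> locally c (fun t => forall i, Q i t).
Proof.
  intros [l Hl] HQ.
  cut (locally c (fun t => forall i, In i l -> Q i t)).
  { apply filter_imp; intros t Ht i; apply Ht, Hl. }
  clear Hl; induction l as [|j l IH].
  - apply filter_forall; intros t i [].
  - generalize (filter_and _ _ (HQ j) IH); apply filter_imp.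
    intros t [Hj Ht] i [<-|Hi]; auto.
Qed.

Lemma finite_upper_bound (I : Type) (g : I -> R) :
  FinFun.Finite I -> exists B, 0 <= B /\ forall i, g i <= B.
Proof.
  intros [l Hl].
  cut (exists B, 0 <= B /\ forall i, In i l -> g i <= B).
  { intros [B [HB H]]; exists B; split; auto. }
  clear Hl; induction l as [|j l [B [HB H]]].
  - exists 0; split; [lra | intros i []].
  - exists (Rmax (g j) B); split.
    + apply Rle_trans with (1 := HB), Rmax_r.
    + intros i [<-|Hi]; [apply Rmax_l |].
      apply Rle_trans with (1 := H i Hi), Rmax_r.
Qed.

(** * Polynomials in several variables, evaluated at reals and at power series *)

(** Expressions rather than coefficient families: evaluation at reals, at power
    series and at bounds are then parallel recursions, and every estimate is
    an induction on the expression.  The type [I] indexes the variables. *)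
Inductive poly (I : Type) : Type :=
| PConst (c : R)
| PVar (i : I)
| PAdd (P Q : poly I)
| PMul (P Q : poly I).
Arguments PConst {I}. Arguments PVar {I}.
Arguments PAdd {I}. Arguments PMul {I}.

Section Evaluation.
Context {I : Type}.

Fixpoint eval (P : poly I) (u : I -> R) : R :=
  match P with
  | PConst c => c
  | PVar i => u i
  | PAdd P Q => eval P u + eval Q u
  | PMul P Q => eval P u * eval Q u
  end.

Fixpoint PPow (P : poly I) (n : nat) : poly I :=
  match n with
  | O => PConst 1
  | S n => PMul P (PPow P n)
  end.

Lemma eval_PPow P n u : eval (PPow P n) u = eval P u ^ n.
Proof. induction n as [|n IH]; simpl; [|rewrite IH]; reflexivity. Qed.

(** The value at [(M, ..., M)] of the polynomial obtained by replacing every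
    constant by its absolute value. *)
Fixpoint majorant (P : poly I) (M : R) : R :=
  match P with
  | PConst c => Rabs c
  | PVar _ => M
  | PAdd P Q => majorant P M + majorant Q M
  | PMul P Q => majorant P M * majorant Q M
  end.

Fixpoint eval_series (P : poly I) (a : I -> nat -> R) : nat -> R :=
  match P with
  | PConst c => fun n => match n with O => c | S _ => 0 end
  | PVar i => a i
  | PAdd P Q => fun n => eval_series P a n + eval_series Q a n
  | PMul P Q => PS_mult (eval_series P a) (eval_series Q a)
  end.

Lemma majorant_ge0 P M : 0 <= M -> 0 <= majorant P M.
Proof.
  intros HM; induction P; simpl; auto using Rabs_pos, Rplus_le_le_0_compat, Rmult_le_pos.
Qed.

Lemma eval_bounded P M (u : I -> R) :
  (forall i, Rabs (u i) <= M) -> Rabs (eval P u) <= majorant P M.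
Proof.
  intros Hu; induction P; simpl; auto using Rle_refl.
  - eapply Rle_trans; [apply Rabs_triang | lra].
  - rewrite Rabs_mult; apply Rmult_le_compat; auto using Rabs_pos.
Qed.

(** Products are handled by [xy - x'y' = (x - x')y + x'(y - y')] and the
    boundedness of each factor. *)
Lemma eval_lipschitz P M : 0 <= M -> exists L, 0 <= L /\
  forall (u v : I -> R) K,
    (forall i, Rabs (u i) <= M) -> (forall i, Rabs (v i) <= M) ->
    (forall i, Rabs (u i - v i) <= K) ->
    Rabs (eval P u - eval P v) <= L * K.
Proof.
  intros HM; induction P as [c | i | P [L [HL IHP]] Q [L' [HL' IHQ]]
    | P [L [HL IHP]] Q [L' [HL' IHQ]]]; simpl.
  - exists 0; split; [lra|]; intros u v K _ _ _.
    rewrite Rminus_diag, Rabs_R0; lra.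
  - exists 1; split; [lra|]; intros u v K _ _ H; rewrite Rmult_1_l; apply H.
  - exists (L + L'); split; [lra|]; intros u v K Hu Hv H.
    replace (_ - _) with ((eval P u - eval P v) + (eval Q u - eval Q v)) by ring.
    eapply Rle_trans; [apply Rabs_triang|].
    specialize (IHP u v K Hu Hv H); specialize (IHQ u v K Hu Hv H); lra.
  - exists (L * majorant Q M + majorant P M * L').
    assert (HP0 := majorant_ge0 P M HM); assert (HQ0 := majorant_ge0 Q M HM).
    split; [apply Rplus_le_le_0_compat; apply Rmult_le_pos; assumption|].
    intros u v K Hu Hv H.
    replace (_ - _) with
      ((eval P u - eval P v) * eval Q u + eval P v * (eval Q u - eval Q v)) by ring.
    eapply Rle_trans; [apply Rabs_triang|]; rewrite !Rabs_mult.
    replace (_ * K) with (L * K * majorant Q M + majorant P M * (L' * K)) by ring.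
    apply Rplus_le_compat; apply Rmult_le_compat; auto using Rabs_pos, eval_bounded.
Qed.

(** Coefficients of sums and Cauchy products only look at lower coefficients;
    this makes the recursion for the formal solution well founded. *)
Lemma eval_series_ext_le P (a b : I -> nat -> R) n :
  (forall i k, (k <= n)%nat -> a i k = b i k) ->
  eval_series P a n = eval_series P b n.
Proof.
  revert n; induction P as [c | i | P IHP Q IHQ | P IHP Q IHQ]; simpl; intros n H; auto.
  - rewrite (IHP n H), (IHQ n H); reflexivity.
  - apply sum_eq; intros k Hk; rewrite (IHP k), (IHQ (n - k)%nat); auto;
      intros i m Hm; apply H; lia.
Qed.

(** * Weighted partial sums of power series *)

Definition partial_norm (r : R) (a : nat -> R) (N : nat) : R :=
  sum_f_R0 (fun k => Rabs (a k) * r ^ k) N.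

Lemma partial_norm_ge0 r a N : 0 <= r -> 0 <= partial_norm r a N.
Proof.
  intros Hr; apply cond_pos_sum; intros k; auto using Rmult_le_pos, Rabs_pos, pow_le.
Qed.

(** The left-hand side collects the products [f i * g j] with [i + j <= N], the
    right-hand side all those with [i, j <= N]. *)
Lemma cauchy_product_partial_sum_le (f g : nat -> R) N :
  (forall n, 0 <= f n) -> (forall n, 0 <= g n) ->
  sum_f_R0 (fun n => sum_f_R0 (fun k => f k * g (n - k)%nat) n) N
  <= sum_f_R0 f N * sum_f_R0 g N.
Proof.
  intros Hf Hg; destruct N as [|N]; [simpl; lra|].
  rewrite (cauchy_finite f g (S N)) by lia.
  match goal with |- ?x <= ?x + ?y => cut (0 <= y); [lra|] end.
  apply cond_pos_sum; intros n; apply cond_pos_sum; intros k.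
  apply Rmult_le_pos; auto.
Qed.

Lemma partial_norm_mult_le r a b N : 0 <= r ->
  partial_norm r (PS_mult a b) N <= partial_norm r a N * partial_norm r b N.
Proof.
  intros Hr; unfold partial_norm.
  eapply Rle_trans; [| apply cauchy_product_partial_sum_le;
    intros k; auto using Rmult_le_pos, Rabs_pos, pow_le].
  apply sum_Rle; intros n _; unfold PS_mult.
  eapply Rle_trans.
  { apply Rmult_le_compat_r; [apply pow_le, Hr | apply Rsum_abs]. }
  rewrite Rmult_comm, scal_sum; right; apply sum_eq; intros k Hk.
  rewrite Rabs_mult; replace n with (k + (n - k))%nat at 2 by lia.
  rewrite pow_add; ring.
Qed.

(** The bound on [F(a)] up to order [N] uses [a] up to order [N] only, which is
    what lets an induction on [N] run. *)
Lemma partial_norm_eval_series P (a : I -> nat -> R) r M N :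
  0 <= r -> (forall i, partial_norm r (a i) N <= M) ->
  partial_norm r (eval_series P a) N <= majorant P M.
Proof.
  intros Hr Ha; induction P as [c | i | P IHP Q IHQ | P IHP Q IHQ]; simpl; auto.
  - right; clear Ha; unfold partial_norm; induction N as [|N IH]; simpl in *.
    + ring.
    + rewrite IH, Rabs_R0; ring.
  - eapply Rle_trans; [| apply Rplus_le_compat; [exact IHP | exact IHQ]].
    unfold partial_norm; rewrite <- sum_plus.
    apply sum_Rle; intros n _; rewrite <- Rmult_plus_distr_r.
    apply Rmult_le_compat_r; [apply pow_le, Hr | apply Rabs_triang].
  - eapply Rle_trans; [apply partial_norm_mult_le, Hr |].
    apply Rmult_le_compat; auto using partial_norm_ge0.
Qed.

Lemma partial_norm_CV_radius r a M :
  0 <= r -> (forall N, partial_norm r a N <= M) -> Rbar_le r (CV_radius a).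
Proof.
  intros Hr H; apply (proj1 (CV_radius_bounded a)); exists M; intros n.
  apply Rle_trans with (2 := H n).
  rewrite Rabs_mult, (Rabs_pos_eq (r ^ n)) by apply pow_le, Hr.
  destruct n as [|n]; [apply Rle_refl|].
  unfold partial_norm; simpl sum_f_R0.
  assert (H0 := partial_norm_ge0 r a n Hr); unfold partial_norm in H0; simpl in *; lra.
Qed.

(** The bound on partial norms is inherited by every subexpression, so all the
    series that occur converge absolutely at [t] and may be multiplied. *)
Lemma is_pseries_eval_series P (a : I -> nat -> R) r M t :
  0 <= r -> (forall i N, partial_norm r (a i) N <= M) -> Rabs t < r ->
  is_pseries (eval_series P a) t (eval P (fun i => PSeries (a i) t)).
Proof.
  intros Hr Ha Ht.
  assert (HCV : forall Q, Rbar_lt (Rabs t) (CV_radius (eval_series Q a))).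
  { intros Q; apply Rbar_lt_le_trans with r; [exact Ht|].
    apply partial_norm_CV_radius with (majorant Q M); [exact Hr|].
    intros N; apply partial_norm_eval_series; auto. }
  induction P as [c | i | P IHP Q IHQ | P IHP Q IHQ].
  (* A constant series is its first coefficient plus [t] times the zero series. *)
  - assert (H := PSeries_correct _ _ (CV_radius_inside _ _ (HCV (PConst c)))).
    replace (PSeries _ t) with c in H; [exact H|].
    rewrite PSeries_decr_1 by apply (CV_radius_inside _ _ (HCV (PConst c))).
    rewrite (PSeries_ext (PS_decr_1 _) (fun _ => 0)) by reflexivity.
    rewrite PSeries_const_0; simpl; ring.
  - apply (PSeries_correct (a i)), CV_radius_inside, (HCV (PVar i)).
  - apply (is_pseries_plus _ _ _ _ _ IHP IHQ).
  - apply (is_pseries_mult _ _ _ _ _ IHP IHQ (HCV P) (HCV Q)).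
Qed.

End Evaluation.

(** * Power series solutions of polynomial ODE systems *)

Definition solves {I : Type} (F : I -> poly I) (u : I -> R -> R) : Prop :=
  locally 0 (fun t => forall i, is_derive (u i) t (eval (F i) (fun j => u j t))).

Section FormalSolution.
Context {I : Type} (F : I -> poly I) (u0 : I -> R).

(** Formal Picard operator [a |-> u0 + integral of F(a)]. *)
Definition picard (a : I -> nat -> R) (i : I) (n : nat) : R :=
  match n with
  | O => u0 i
  | S m => eval_series (F i) a m / INR (S m)
  end.

(** Each Picard step fixes one more coefficient, so the coefficient of order [n]
    has settled after [n + 1] steps, whatever the starting series. *)
Definition formal_solution (i : I) (n : nat) : R :=
  Nat.iter (S n) picard (fun _ _ => 0) i n.

Lemma picard_iter_stable n : forall m m' i, (n < m)%nat -> (n < m')%nat ->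
  Nat.iter m picard (fun _ _ => 0) i n = Nat.iter m' picard (fun _ _ => 0) i n.
Proof.
  induction n as [n IH] using (well_founded_ind Nat.lt_wf_0); intros m m' i Hm Hm'.
  destruct m as [|m]; [lia|]; destruct m' as [|m']; [lia|].
  destruct n as [|n]; [reflexivity|].
  change (eval_series (F i) (Nat.iter m picard (fun _ _ => 0)) n / INR (S n)
        = eval_series (F i) (Nat.iter m' picard (fun _ _ => 0)) n / INR (S n)).
  f_equal; apply eval_series_ext_le; intros j k Hk; apply IH; lia.
Qed.

(** The formal solution is a fixed point of the Picard operator: this is the
    differential equation, coefficient by coefficient. *)
Lemma formal_solution_S i n :
  formal_solution i (S n) = eval_series (F i) formal_solution n / INR (S n).
Proof.
  change (eval_series (F i) (Nat.iter (S n) picard (fun _ _ => 0)) n / INR (S n)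
        = eval_series (F i) formal_solution n / INR (S n)).
  f_equal; apply eval_series_ext_le; intros j k Hk.
  apply picard_iter_stable; lia.
Qed.

(** Dividing by [n + 1] in the recursion can only decrease coefficients, so
    passing from order [N] to order [N + 1] costs the initial value plus [r] times
    a bound for [F(a)] at order [N]; the latter depends on [M] but not on [r]. *)
Lemma partial_norm_formal_solution r M :
  0 <= r -> (forall i, Rabs (u0 i) + 1 <= M) ->
  (forall i, r * majorant (F i) M <= 1) ->
  forall N i, partial_norm r (formal_solution i) N <= M.
Proof.
  intros Hr HM HF N; induction N as [|N IH]; intros i; specialize (HM i).
  { change (Rabs (u0 i) * 1 <= M); lra. }
  apply Rle_trans with (2 := HM).
  unfold partial_norm; rewrite decomp_sum by lia; simpl pred.
  apply Rplus_le_compat; [right; apply Rmult_1_r|].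
  apply Rle_trans with (2 := HF i).
  apply Rle_trans with (r * partial_norm r (eval_series (F i) formal_solution) N).
  - unfold partial_norm; rewrite scal_sum; apply sum_Rle; intros n _.
    rewrite formal_solution_S; unfold Rdiv; rewrite Rabs_mult.
    replace (_ * r) with (Rabs (eval_series (F i) formal_solution n) * 1 * r ^ S n)
      by (simpl; ring).
    apply Rmult_le_compat_r; [apply pow_le, Hr|].
    apply Rmult_le_compat_l; [apply Rabs_pos|].
    rewrite Rabs_pos_eq by (left; apply Rinv_0_lt_compat, lt_0_INR; lia).
    rewrite <- Rinv_1; apply Rinv_le_contravar; [lra|].
    apply (le_INR 1); lia.
  - apply Rmult_le_compat_l; [exact Hr|].
    apply partial_norm_eval_series; assumption.
Qed.

(** Here finiteness of the system matters: [M] and [B] must be uniform in [i]. *)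
Lemma analytic_solution_exists : FinFun.Finite I -> exists a : I -> nat -> R,
  (forall i, Rbar_lt 0 (CV_radius (a i))) /\
  (forall i, PSeries (a i) 0 = u0 i) /\
  solves F (fun i => PSeries (a i)).
Proof.
  intros HI.
  destruct (finite_upper_bound I (fun i => Rabs (u0 i) + 1) HI) as [M [HM0 HM]].
  destruct (finite_upper_bound I (fun i => majorant (F i) M) HI) as [B [HB0 HB]].
  set (r := / (B + 1)).
  assert (Hr : 0 < r) by (apply Rinv_0_lt_compat; lra).
  assert (Hnorm : forall i N, partial_norm r (formal_solution i) N <= M).
  { intros i N; apply partial_norm_formal_solution; [lra | exact HM |].
    intros j; apply Rle_trans with (r * (B + 1)).
    - apply Rmult_le_compat_l; [lra|]; specialize (HB j); lra.
    - unfold r; right; field; lra. }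
  assert (HCV : forall i, Rbar_le r (CV_radius (formal_solution i))).
  { intros i; apply partial_norm_CV_radius with M; [lra|]; auto. }
  exists formal_solution; split; [|split].
  - intros i; apply Rbar_lt_le_trans with r; [exact Hr | apply HCV].
  - intros i; rewrite PSeries_0; reflexivity.
  - exists (mkposreal r Hr); intros t Ht i.
    assert (Ht' : Rabs t < r).
    { change (Rabs (t - 0) < r) in Ht; rewrite Rminus_0_r in Ht; exact Ht. }
    rewrite <- (is_pseries_unique _ _ _
      (is_pseries_eval_series (F i) _ r M t (Rlt_le _ _ Hr) Hnorm Ht')).
    rewrite <- (PSeries_ext (PS_derive (formal_solution i))).
    + apply is_derive_PSeries, Rbar_lt_le_trans with r; [exact Ht' | apply HCV].
    + intros n; unfold PS_derive; rewrite formal_solution_S; field.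
      apply not_0_INR; lia.
Qed.

End FormalSolution.

(** * Uniqueness and analyticity of solutions *)

(** The difference is bounded on an interval on which the Lipschitz constant
    times the length is at most [1/2]; the mean value inequality then halves any
    bound, because both solutions start at the same point. *)
Lemma solves_unique {I : Type} (F : I -> poly I) (u v : I -> R -> R) :
  FinFun.Finite I -> solves F u -> solves F v -> (forall i, u i 0 = v i 0) ->
  locally 0 (fun t => forall i, u i t = v i t).
Proof.
  intros HI Hu Hv H0.
  destruct (finite_upper_bound I (fun i => Rabs (u i 0) + 1) HI) as [M [HM0 HM]].
  assert (Hbound : forall w, solves F w -> (forall i, w i 0 = u i 0) ->
    locally 0 (fun t => forall i, Rabs (w i t) <= M)).
  { intros w Hw Hw0; apply locally_forall_finite; [exact HI|]; intros i.
    assert (Hc : continuous (w i) 0).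
    { apply (@ex_derive_continuous R_AbsRing R_NormedModule).
      eexists; apply (locally_singleton _ _ Hw i). }
    generalize (proj1 (filterlim_locally _ _) Hc (mkposreal 1 Rlt_0_1)).
    apply filter_imp; intros t Ht.
    change (Rabs (w i t - w i 0) < 1) in Ht; specialize (HM i).
    rewrite Hw0 in Ht; generalize (Rabs_triang_inv (w i t) (u i 0)); lra. }
  assert (HL : exists L, 0 <= L /\ forall i (x y : I -> R) K, 0 <= K ->
    (forall j, Rabs (x j) <= M) -> (forall j, Rabs (y j) <= M) ->
    (forall j, Rabs (x j - y j) <= K) ->
    Rabs (eval (F i) x - eval (F i) y) <= L * K).
  { destruct (choice _ (fun i => eval_lipschitz (F i) M HM0)) as [l Hl].
    destruct (finite_upper_bound I l HI) as [L [HL0 HL]].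
    exists L; split; [exact HL0|]; intros i x y K HK Hx Hy Hxy.
    apply Rle_trans with (l i * K); [apply Hl; assumption|].
    apply Rmult_le_compat_r; auto. }
  destruct HL as [L [HL0 HL]].
  destruct (filter_and _ _ (filter_and _ _ Hu Hv)
    (filter_and _ _ (Hbound u Hu (fun i => eq_refl))
       (Hbound v Hv (fun i => eq_sym (H0 i))))) as [d Hd].
  assert (Hd0 := cond_pos d).
  set (e := Rmin d (/ (2 * (L + 1)))).
  assert (He : 0 < e).
  { apply Rmin_pos; [exact Hd0 | apply Rinv_0_lt_compat; lra]. }
  assert (HeL : L * e <= / 2).
  { apply Rle_trans with ((L + 1) * / (2 * (L + 1))); [|right; field; lra].
    apply Rmult_le_compat; [exact HL0 | lra | lra | apply Rmin_r]. }
  assert (Hball : forall t, Rabs t < e -> ball 0 d t).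
  { intros t Ht; change (Rabs (t - 0) < d); rewrite Rminus_0_r.
    apply Rlt_le_trans with (1 := Ht), Rmin_l. }
  assert (Hhalf : forall n t, Rabs t < e -> forall i,
    Rabs (u i t - v i t) <= 2 * M * (/ 2) ^ n).
  { induction n as [|n IH]; intros t Ht i.
    - destruct (Hd t (Hball t Ht)) as [_ [Hut Hvt]].
      specialize (Hut i); specialize (Hvt i).
      eapply Rle_trans; [apply Rabs_triang|]; rewrite Rabs_Ropp; simpl; lra.
    - set (K := 2 * M * (/ 2) ^ n) in *.
      assert (HK : 0 <= K).
      { apply Rle_trans with (2 := IH t Ht i), Rabs_pos. }
      assert (H := bounded_variation (fun s => u i s - v i s)
        (fun s => eval (F i) (fun j => u j s) - eval (F i) (fun j => v j s))
        (L * K) 0 t).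
      cbv beta in H; rewrite (H0 i), Rminus_diag, !Rminus_0_r in H.
      apply Rle_trans with (L * K * Rabs t).
      + apply H; intros s Hs; rewrite Rminus_0_r in Hs.
        assert (Hs' : Rabs s < e) by lra.
        destruct (Hd s (Hball s Hs')) as [[Hus Hvs] [Hbu Hbv]]; split.
        * apply (is_derive_minus (u i) (v i) s _ _ (Hus i) (Hvs i)).
        * apply HL; auto.
      + simpl; replace (2 * M * _) with (/ 2 * K) by (unfold K; ring).
        apply Rle_trans with (L * e * K); [|apply Rmult_le_compat_r; auto].
        replace (L * e * K) with (L * K * e) by ring.
        apply Rmult_le_compat_l; [apply Rmult_le_pos; auto | lra]. }
  exists (mkposreal e He); intros t Ht i.
  change (Rabs (t - 0) < e) in Ht; rewrite Rminus_0_r in Ht.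
  apply Rminus_diag_uniq; destruct (Req_dec (u i t - v i t) 0) as [|Hne]; [assumption|].
  exfalso; apply Rabs_pos_lt in Hne.
  destruct (pow_lt_1_zero (/ 2)) with (y := Rabs (u i t - v i t) / (2 * M + 1))
    as [N HN]; [rewrite Rabs_pos_eq; lra | apply Rdiv_lt_0_compat; lra |].
  specialize (HN N (le_n N)); specialize (Hhalf N t Ht i).
  rewrite Rabs_pos_eq in HN by (apply pow_le; lra).
  apply (Rlt_div_r _ _ _) in HN; [|lra].
  assert (0 <= (/ 2) ^ N) by (apply pow_le; lra); lra.
Qed.

(** The Taylor coefficients only depend on the germ of [f], and those of a power
    series are its coefficients. *)
Lemma analytic_at_PSeries (a : nat -> R) (f : R -> R) :
  Rbar_lt 0 (CV_radius a) -> locally 0 (fun t => PSeries a t = f t) ->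
  analytic_at f 0.
Proof.
  intros Ha Hf.
  assert (Hr : locally 0 (fun t => Rbar_lt (Rabs t) (CV_radius a))).
  { destruct (CV_radius a) as [r| |]; [|apply filter_forall; exact (fun _ => I)|easy].
    exists (mkposreal r Ha); intros t Ht.
    change (Rabs (t - 0) < r) in Ht; rewrite Rminus_0_r in Ht; exact Ht. }
  split.
  - intros n; generalize (filter_and _ _ Hr (locally_locally _ _ Hf)).
    apply filter_imp; intros t [Ht Hft].
    apply (ex_derive_n_ext_loc (PSeries a)); [exact Hft|].
    apply ex_derive_n_PSeries, Ht.
  - generalize (filter_and _ _ Hr Hf); apply filter_imp; intros t [Ht <-].
    rewrite Rminus_0_r; apply is_pseries_ext with a.
    + intros n; rewrite <- (Derive_n_ext_loc _ _ n 0 Hf), Derive_n_coef by exact Ha.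
      change (a n = a n * INR (Factorial.fact n) / INR (Factorial.fact n)).
      field; apply INR_fact_neq_0.
    + apply PSeries_correct, CV_radius_inside, Ht.
Qed.

(** The given solution must be the power series solution with the same initial
    values. *)
Theorem solves_analytic {I : Type} (F : I -> poly I) (u : I -> R -> R) :
  FinFun.Finite I -> solves F u -> forall i, analytic_at (u i) 0.
Proof.
  intros HI Hu i.
  destruct (analytic_solution_exists F (fun i => u i 0) HI) as [a [Ha [Ha0 Hsol]]].
  apply analytic_at_PSeries with (a i); [apply Ha|].
  generalize (solves_unique F _ u HI Hsol Hu Ha0).
  apply filter_imp; auto.
Qed.

(** * The function sin_p *)

Inductive sin_var := Sx | Sy.

Lemma sin_var_finite : FinFun.Finite sin_var.
Proof. exists (Sx :: Sy :: nil); intros []; simpl; auto. Qed.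

Definition sin_system (p : nat) (i : sin_var) : poly sin_var :=
  match i with
  | Sx => PMul (PConst (-1)) (PPow (PVar Sy) (p - 1))
  | Sy => PPow (PVar Sx) (p - 1)
  end.

Definition sin_state (x y : R -> R) (i : sin_var) : R -> R :=
  match i with Sx => x | Sy => y end.

Lemma solves_sin_system p x y :
  solves (sin_system p) (sin_state x y) <->
  locally 0 (fun t => is_derive x t (- (y t ^ (p - 1))) /\
                      is_derive y t (x t ^ (p - 1))).
Proof.
  unfold solves; split; apply filter_imp; intros t H.
  - split.
    + generalize (H Sx); simpl; rewrite eval_PPow; simpl.
      intros Hx; replace (- _) with (-1 * y t ^ (p - 1)) by ring; exact Hx.
    + generalize (H Sy); simpl; rewrite eval_PPow; auto.
  - intros []; simpl; rewrite eval_PPow; simpl; [|apply H].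
    replace (-1 * _) with (- (y t ^ (p - 1))) by ring; apply H.
Qed.

(** Without a solution the choice defining [sin_p] would be arbitrary. *)
Lemma is_sin_p_exists p : exists y, is_sin_p p y.
Proof.
  destruct (analytic_solution_exists (sin_system p)
    (fun i => match i with Sx => 1 | Sy => 0 end) sin_var_finite)
    as [a [_ [Ha0 Hsol]]].
  destruct (proj1 (solves_sin_system p (PSeries (a Sx)) (PSeries (a Sy)))) as [d Hd].
  { apply filter_imp with (2 := Hsol); intros t Ht i.
    generalize (Ht i); destruct i; simpl; rewrite !eval_PPow; auto. }
  assert (Hd0 := cond_pos d).
  exists (PSeries (a Sy)), (- d), d, (PSeries (a Sx)); split; [lra|].
  split; [apply (Ha0 Sx)|]; split; [apply (Ha0 Sy)|].
  intros t Ht; apply Hd; change (Rabs (t - 0) < d).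
  apply Rabs_def1; lra.
Qed.

Lemma is_sin_p_analytic p y : is_sin_p p y -> analytic_at y 0.
Proof.
  intros [a [b [x [Hab [_ [_ Hivp]]]]]].
  apply (solves_analytic (sin_system p) (sin_state x y) sin_var_finite) with (i := Sy).
  apply solves_sin_system.
  apply (locally_interval _ 0 a b); [apply Hab | apply Hab |].
  intros t Ha Hb; apply Hivp; split; [exact Ha | exact Hb].
Qed.

(** * The function arcsin_p *)

(** Names of the unknowns [t], [g = 1 / (1 - t^p)],
    [h = (1 - t^p)^(-(p-1)/p)] and [arcsin_p t]. *)
Inductive arcsin_var := At | Ag | Ah | Az.

Lemma arcsin_var_finite : FinFun.Finite arcsin_var.
Proof. exists (At :: Ag :: Ah :: Az :: nil); intros []; simpl; auto. Qed.

Definition arcsin_system (p : nat) (i : arcsin_var) : poly arcsin_var :=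
  match i with
  | At => PConst 1
  | Ag => PMul (PConst (INR p)) (PMul (PPow (PVar At) (p - 1)) (PPow (PVar Ag) 2))
  | Ah => PMul (PConst (INR (p - 1)))
            (PMul (PPow (PVar At) (p - 1)) (PMul (PVar Ag) (PVar Ah)))
  | Az => PVar Ah
  end.

Definition arcsin_p_integrand (p : nat) (t : R) : R :=
  / Rpower (1 - t ^ p) (INR (p - 1) / INR p).

Definition arcsin_state (p : nat) (i : arcsin_var) : R -> R :=
  match i with
  | At => fun t => t
  | Ag => fun t => / (1 - t ^ p)
  | Ah => arcsin_p_integrand p
  | Az => arcsin_p p
  end.

Lemma one_minus_pow_pos p t : (0 < p)%nat -> Rabs t < 1 -> 0 < 1 - t ^ p.
Proof.
  intros Hp Ht; apply Rlt_0_minus, Rle_lt_trans with (1 := Rle_abs _).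
  rewrite <- RPow_abs; apply pow_lt_1_compat; [|exact Hp].
  split; [apply Rabs_pos | exact Ht].
Qed.

Lemma is_derive_one_minus_pow p t :
  is_derive (fun s => 1 - s ^ p) t (- (INR p * t ^ (p - 1))).
Proof.
  auto_derive; [trivial|]; rewrite Nat.sub_1_r; ring.
Qed.

(** With [al = (p-1)/p], the derivative of [(1 - t^p)^(-al)] is
    [al p t^(p-1) (1 - t^p)^(-al-1)]; the factor [al p = p - 1] and splitting off
    [1 / (1 - t^p)] make it polynomial in the unknowns. *)
Lemma is_derive_arcsin_p_integrand p t : (0 < p)%nat -> Rabs t < 1 ->
  is_derive (arcsin_p_integrand p) t
    (INR (p - 1) * (t ^ (p - 1) * (/ (1 - t ^ p) * arcsin_p_integrand p t))).
Proof.
  intros Hp Ht; assert (H1 := one_minus_pow_pos p t Hp Ht).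
  assert (Hp0 : INR p <> 0) by (apply not_0_INR; lia).
  set (al := INR (p - 1) / INR p).
  apply is_derive_ext with (fun s => Rpower (1 - s ^ p) (- al)).
  { intros s; apply Rpower_Ropp. }
  assert (Hpow : is_derive (fun z => Rpower z (- al)) (1 - t ^ p)
                   (- al * Rpower (1 - t ^ p) (- al - 1))).
  { apply is_derive_Reals, derivable_pt_lim_power, H1. }
  generalize (is_derive_comp _ _ t _ _ Hpow (is_derive_one_minus_pow p t)).
  replace (scal _ _) with
    (INR (p - 1) * (t ^ (p - 1) * (/ (1 - t ^ p) * arcsin_p_integrand p t))); auto.
  unfold arcsin_p_integrand; fold al; rewrite <- Rpower_Ropp.
  unfold Rminus at 4; rewrite Rpower_plus, (Rpower_Ropp _ 1), Rpower_1 by exact H1.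
  unfold scal; simpl; unfold mult; simpl; unfold al; field; lra.
Qed.

Lemma is_derive_arcsin_p p t : (0 < p)%nat -> Rabs t < 1 ->
  is_derive (arcsin_p p) t (arcsin_p_integrand p t).
Proof.
  intros Hp Ht.
  assert (Hc : forall s, Rabs s < 1 -> continuous (arcsin_p_integrand p) s).
  { intros s Hs; apply (@ex_derive_continuous R_AbsRing R_NormedModule).
    eexists; apply is_derive_arcsin_p_integrand; assumption. }
  apply (is_derive_RInt (arcsin_p_integrand p) (arcsin_p p) 0); [|apply Hc, Ht].
  apply Rabs_def2 in Ht.
  apply (locally_interval _ t (-1) 1); [apply Ht | apply Ht |].
  simpl; intros b Hb1 Hb2.
  apply (RInt_correct (arcsin_p_integrand p)), ex_RInt_continuous; intros s Hs.
  apply Hc, Rabs_def1.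
  - apply Rle_lt_trans with (1 := proj2 Hs); apply Rmax_lub_lt; lra.
  - apply Rlt_le_trans with (2 := proj1 Hs); apply Rmin_glb_lt; lra.
Qed.

Lemma solves_arcsin_system p : (0 < p)%nat ->
  solves (arcsin_system p) (arcsin_state p).
Proof.
  intros Hp; exists (mkposreal 1 Rlt_0_1); intros t Ht.
  change (Rabs (t - 0) < 1) in Ht; rewrite Rminus_0_r in Ht.
  intros []; cbn [arcsin_system arcsin_state eval]; rewrite ?eval_PPow; cbn [eval].
  - apply (@is_derive_id R_AbsRing).
  - assert (H1 := one_minus_pow_pos p t Hp Ht).
    generalize (is_derive_inv _ _ _ (is_derive_one_minus_pow p t)
      (Rgt_not_eq _ _ H1)).
    replace (- - _ / _) with (INR p * (t ^ (p - 1) * (/ (1 - t ^ p)) ^ 2)); auto.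
    field; lra.
  - apply is_derive_arcsin_p_integrand; assumption.
  - apply is_derive_arcsin_p; assumption.
Qed.

Theorem theorem3p8 (p : nat) (hp : (1 < p)%nat) :
  analytic_at (arcsin_p p) 0 /\ analytic_at (sin_p p) 0.
Proof.
  split.
  - apply (solves_analytic (arcsin_system p) (arcsin_state p) arcsin_var_finite)
      with (i := Az).
    apply solves_arcsin_system; lia.
  - apply is_sin_p_analytic with p; unfold sin_p; apply epsilon_spec, is_sin_p_exists.
Qed.
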